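(* Let $\mathbb{F}_q$ be a finite field, let $G\le\mathbb{F}_q^\ast$ be a multiplicative subgroup of order $r-1$, and let $\beta\in\mathbb{F}_q^\ast$. Let $\mathcal{A}=\{0\}\cup\beta G$, so that $|\mathcal{A}|=r$. Assume that $p=\operatorname{char}(\mathbb{F}_q)$ divides $r$. Choose $\lambda\in\mathbb{F}_q^\ast$ and arbitrary nonzero scalars $u_\alpha\in\mathbb{F}_q^\ast$, $\alpha\in\mathcal{A}$. Define the multiplier matrix $V\in(\mathbb{F}_q^\ast)^{2\times r}$, with columns indexed by the evaluation points $\alpha\in\mathcal{A}$, by \[ v_{1,\alpha}=u_\alpha,\qquad v_{2,\alpha}=\lambda u_\alpha^{-1}. \] Then the HRS code $C=\operatorname{HRS}_r(\mathcal{A},V,2,r)$ is reverse self-dual.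
   Context: For an integer $h\ge 0$, $\mathcal{P}_{<h}=\{f\in\mathbb{F}_q[x]:\deg f<h\}$. Hasse derivative: for $f(x)=\sum_\ell f_\ell x^\ell\in\mathbb{F}_q[x]$ and $j\ge0$, $\partial^{(j)}f(x)=\sum_{\ell}\binom{\ell}{j}f_\ell x^{\ell-j}$ (with $\binom{\ell}{j}=0$ if $j>\ell$). Hyperderivative Reed–Solomon (HRS) code: for a set $\mathcal{A}=\{\alpha_1,\ldots,\alpha_r\}$ of $r$ distinct elements of $\mathbb{F}_q$, $V=(v_{i,j})\in(\mathbb{F}_q^\ast)^{s\times r}$ (one may index columns by the points $\alpha\in\mathcal{A}$ themselves) and $0\le k\le rs$, \[ \operatorname{HRS}_k(\mathcal{A},V,s,r)=\left\{\bigl(v_{i,j}\,\partial^{(i-1)}f(\alpha_j)\bigr)_{1\le i\le s,\,1\le j\le r}: f\in\mathcal{P}_{<k}\right\}\subseteq\operatorname{Mat}_{s\times r}(\mathbb{F}_q). \] Reverse bilinear form on $\operatorname{Mat}_{s\times r}(\mathbb{F}_q)$: $[A,B]_{\rm rev}=\sum_{j=1}^r\sum_{i=1}^s a_{i,j}b_{s-i+1,j}$. The reverse dual of a linear code $C$ is $C^{\perp_{\rm rev}}=\{B:[A,B]_{\rm rev}=0\text{ for all }A\in C\}$, and $C$ is reverse self-dual if $C=C^{\perp_{\rm rev}}$. *)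

(* Defs.v *)
From HB Require Import structures.
From mathcomp Require Import all_boot all_order all_algebra all_fingroup.

Set Implicit Arguments.
Unset Strict Implicit.
Unset Printing Implicit Defensive.

Import GRing.Theory.
Local Open Scope ring_scope.

Section HRSCodes.

Variables (F : finFieldType) (s r : nat).

(* [f^`N(i)] is the Hasse derivative: its coefficient of 'X^l is
   'C(i + l, i) times f`_(i + l).  Rows are numbered from 0, so row [i] carries
   the derivative of order [i].  The evaluation set is given by an enumeration
   [alpha] of its points, meant to be duplicate-free. *)
Definition hrs_word (alpha : r.-tuple F) (V : 'M[F]_(s, r)) (f : {poly F}) :
    'M[F]_(s, r) :=
  \matrix_(i < s, j < r) (V i j * (f^`N(i)).[tnth alpha j]).

(* [{poly_k F}] is the type of polynomials of size at most [k], that is, of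
   degree < [k]. *)
Definition HRS (k : nat) (alpha : r.-tuple F) (V : 'M[F]_(s, r)) :
    {set 'M[F]_(s, r)} :=
  [set hrs_word alpha V (val f) | f : {poly_k F}].

(* [rev_ord i] is s - 1 - i, i.e. s - i + 1 when rows are numbered from 1. *)
Definition rev_form (A B : 'M[F]_(s, r)) : F :=
  \sum_(j < r) \sum_(i < s) A i j * B (rev_ord i) j.

Definition rev_dual (C : {set 'M[F]_(s, r)}) : {set 'M[F]_(s, r)} :=
  [set B | [forall A in C, rev_form A B == 0]].

Definition reverse_self_dual (C : {set 'M[F]_(s, r)}) : Prop :=
  C = rev_dual C.

End HRSCodes.

Definition zero_coset (F : finFieldType) (G : {group {unit F}}) (beta : F) :
    {set F} :=
  0 |: [set beta * FinRing.uval g | g in G].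

(* The 2 x r multiplier matrix with rows u_alpha and lambda / u_alpha; column
   [j] belongs to the point [tnth alpha j]. *)
Definition pair_multiplier (F : finFieldType) (r : nat) (alpha : r.-tuple F)
    (lambda : F) (u : F -> F) : 'M[F]_(2, r) :=
  \matrix_(i < 2, j < r)
    (if i == 0 then u (tnth alpha j) else lambda * (u (tnth alpha j))^-1).

(* Main.v *)
(** The reverse pairing of the words of f and g is lambda times the sum of
    (f g)' over the evaluation set A, where deg (f g)' <= 2r - 3.  The power
    sums over A of exponent m <= 2r - 3 vanish unless m = r - 1 (for m = 0
    because p divides r), and the coefficient of x^(r-1) in a derivative is a
    multiple of r, hence zero.  So the code is self-orthogonal.  Conversely,
    a matrix in the dual is corrected by the codeword interpolating its first
    row; the remainder has zero first row, and pairing it with the words of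
    Lagrange polynomials shows that its second row vanishes too. *)

Require Import Defs.
From mathcomp Require Import all_boot all_order all_algebra all_fingroup.
From mathcomp Require Import cyclic ring.

Import GRing.Theory.
Local Open Scope ring_scope.

Lemma interpolation (F : fieldType) (n : nat) (x : n.-tuple F)
    (y : 'I_n -> F) :
  uniq x ->
  exists2 f : {poly F}, (size f <= n)%N & forall j, f.[tnth x j] = y j.
Proof.
move=> /tuple_uniqP x_inj.
pose L (i : 'I_n) : {poly F} := \prod_(k | k != i) ('X - (tnth x k)%:P).
have L_diag i : (L i).[tnth x i] != 0.
  rewrite horner_prod; apply/prodf_neq0 => k neq_ki.
  by rewrite hornerXsubC subr_eq0 (inj_eq x_inj) eq_sym.
have L_off i j : j != i -> (L i).[tnth x j] = 0.
  move=> neq_ji; rewrite horner_prod (bigD1 j) //= hornerXsubC subrr.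
  exact: mul0r.
exists (\sum_i (y i / (L i).[tnth x i]) *: L i).
  apply: (leq_trans (size_sum _ _ _)); apply/bigmax_leqP => i _.
  apply: (leq_trans (size_scale_leq _ _)).
  (* [L i] has n - 1 linear factors, hence size n; the index [i] itself witnesses n > 0. *)
  rewrite /L -big_filter size_prod_XsubC size_filter.
  by rewrite -sum1_count sum1_card cardC1 card_ord prednK //
    (leq_trans _ (ltn_ord i)).
move=> j; rewrite horner_sum (bigD1 j) //= hornerZ divfK // big1 ?addr0 //.
by move=> i neq_ij; rewrite hornerZ (L_off i j) ?mulr0 1?eq_sym.
Qed.

Lemma mem_HRS (F : finFieldType) (s r k : nat) (alpha : r.-tuple F)
    (V : 'M[F]_(s, r)) (f : {poly F}) :
  (size f <= k)%N -> hrs_word alpha V f \in HRS k alpha V.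
Proof.
by move=> f_lt; apply/imsetP; exists (npolyp k f); rewrite //= npolypK.
Qed.

Section PairMultiplier.

Variables (F : finFieldType) (r : nat) (alpha : r.-tuple F).
Variables (lambda : F) (u : F -> F).

Let V := pair_multiplier alpha lambda u.

Lemma hrs_word_pairE (f : {poly F}) (j : 'I_r) :
  (hrs_word alpha V f 0 j = u (tnth alpha j) * f.[tnth alpha j]) *
  (hrs_word alpha V f 1 j = lambda / u (tnth alpha j) * f^`().[tnth alpha j]).
Proof. by split; rewrite !mxE /= ?nderivn0 ?nderivn1. Qed.

Lemma rev_form2E (A B : 'M[F]_(2, r)) :
  rev_form A B = \sum_j (A 0 j * B 1 j + A 1 j * B 0 j).
Proof.
apply: eq_bigr => j _; rewrite big_ord_recl big_ord1.
have -> : rev_ord (0 : 'I_2) = 1 by apply: val_inj.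
have -> : lift ord0 (ord0 : 'I_1) = (1 : 'I_2) by apply: val_inj.
by have -> : rev_ord (1 : 'I_2) = 0 by apply: val_inj.
Qed.

Hypothesis u_neq0 : forall a, a \in alpha -> u a != 0.

(** In each column the two multipliers have product [lambda], so the two cross terms add up to
    [lambda] times f g' + f' g, and the product rule applies. *)
Lemma rev_form_hrs_word_pair (f g : {poly F}) :
  rev_form (hrs_word alpha V f) (hrs_word alpha V g) =
    lambda * \sum_(a <- alpha) (f * g)^`().[a].
Proof.
rewrite rev_form2E big_tuple mulr_sumr; apply: eq_bigr => j _.
rewrite !hrs_word_pairE derivM hornerD !hornerM.
have := u_neq0 _ (mem_tnth j alpha).
by move: (u _) => w w_neq0; field.
Qed.

Lemma pair_multiplier_self_dual :
    uniq alpha ->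
    (forall f : {poly F}, (size f <= (r.*2).-1)%N ->
       \sum_(a <- alpha) f^`().[a] = 0) ->
  reverse_self_dual (HRS r alpha V).
Proof.
move=> alpha_uniq sum_deriv.
have orth (f g : {poly F}) : (size f <= r)%N -> (size g <= r)%N ->
    rev_form (hrs_word alpha V f) (hrs_word alpha V g) = 0.
  move=> f_lt g_lt.
  rewrite rev_form_hrs_word_pair sum_deriv ?mulr0 //.
  (* The product of two polynomials of size at most r has size at most 2r - 1, the bound in
     [sum_deriv]. *)
  apply: (leq_trans (size_polyMleq _ _)).
  by rewrite -!subn1 leq_sub2r // -addnn leq_add.
apply/setP => B; rewrite inE; apply/idP/forall_inP.
  by move=> /imsetP[g _ ->] A /imsetP[f _ ->]; rewrite orth // size_npoly.
move=> B_dual.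
have [g g_lt gB] := interpolation _ _ alpha (fun j => B 0 j / u (tnth alpha j))
  alpha_uniq.
suff -> : B = hrs_word alpha V g by apply: mem_HRS.
have row0 j : B 0 j = hrs_word alpha V g 0 j.
  by rewrite hrs_word_pairE gB mulrC divfK // u_neq0 ?mem_tnth.
have row1 j : B 1 j = hrs_word alpha V g 1 j.
  have [f f_lt fj] := interpolation _ _ alpha (fun k => (k == j)%:R) alpha_uniq.
  have := B_dual _ (mem_HRS _ _ _ _ _ _ f f_lt).
  (* Subtracting the zero pairing with the word of [g] cancels the first row; as [f] is 1 at point
     [j] and 0 at the others, only the second-row difference in column [j] survives, times a nonzero
     value of [u]. *)
  rewrite -(orth f g) // !rev_form2E -subr_eq0 -sumrB (bigD1 j) //= big1 => [|k neq_kj].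
    rewrite row0 opprD addrACA subrr addr0 -mulrBr hrs_word_pairE fj eqxx.
    rewrite mulr1 addr0 mulf_eq0.
    by rewrite (negPf (u_neq0 _ (mem_tnth j alpha))) subr_eq0 => /eqP.
  rewrite row0 opprD addrACA subrr addr0 -mulrBr hrs_word_pairE fj.
  by rewrite (negPf neq_kj) mulr0 mul0r.
apply/matrixP => i j; case: (boolP (i == 0)) => [/eqP-> //|i_neq0].
suff -> : i = 1 by [].
by apply: val_inj; case: i i_neq0 => [[|[|]]].
Qed.

End PairMultiplier.

(** Multiplication by a generator x of the cyclic group [G] permutes [G], so the sum is unchanged
    when scaled by x^m, and x^m differs from 1. *)
Lemma unit_group_power_sum (F : finFieldType) (G : {group {unit F}}) (m : nat) :
  ~~ (#|G| %| m)%N -> \sum_(g in G) FinRing.uval g ^+ m = 0 :> F.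
Proof.
have /cyclicP[x defG] := field_unit_group_cyclic G.
have xG : x \in G by rewrite defG cycle_id.
rewrite {1}defG -orderE order_dvdn => xm_neq1.
set S := \sum_(g in G) _.
have : FinRing.uval x ^+ m * S = S.
  rewrite mulr_sumr [RHS](reindex_inj (mulgI x)) /=.
  apply: eq_big => g; first by rewrite groupMl.
  by rewrite -exprMn.
move/eqP; rewrite -subr_eq0 -{2}[S]mul1r -mulrBl mulf_eq0 subr_eq0.
by rewrite -FinRing.val_unitX -FinRing.val_unit1 val_eqE (negPf xm_neq1) => /eqP.
Qed.

Section ZeroCoset.

Variables (F : finFieldType) (G : {group {unit F}}) (beta : F).
Hypothesis beta_neq0 : beta != 0.

Lemma coset_inj : injective (fun g : {unit F} => beta * FinRing.uval g).
Proof. by move=> g h /(mulfI beta_neq0)/val_inj. Qed.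

Lemma zero_notin_coset : 0 \notin [set beta * FinRing.uval g | g in G].
Proof.
apply/imsetP => -[g _ /esym/eqP]; rewrite mulf_eq0 (negPf beta_neq0) /=.
by move/eqP => g0; have := valP g; rewrite /= g0 unitr0.
Qed.

Lemma card_zero_coset : #|zero_coset G beta| = #|G|.+1.
Proof. by rewrite cardsU1 zero_notin_coset card_imset //; apply: coset_inj. Qed.

Lemma zero_coset_power_sum (m : nat) :
  #|G|.+1%:R = 0 :> F -> (m < #|G|.*2)%N -> m != #|G| ->
  \sum_(a in zero_coset G beta) a ^+ m = 0.
Proof.
move=> char_dvd m_lt m_neq; case: (posnP m) => [->|m_gt0].
  (* Here 0^0 = 1, so the point 0 counts too and the sum is |G| + 1, which is zero in [F]. *)
  under eq_bigr do rewrite expr0.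
  by rewrite sumr_const card_zero_coset.
rewrite big_setU1 ?zero_notin_coset //= expr0n gtn_eqF //= add0r.
rewrite big_imset /=; last by move=> g h _ _; apply: coset_inj.
under eq_bigr do rewrite exprMn.
rewrite -mulr_sumr unit_group_power_sum ?mulr0 //.
(* The only multiples of |G| below 2|G| are 0 and |G|, both excluded. *)
apply/dvdnP => -[[|[|k]] mE]; move: m_lt m_gt0 m_neq; rewrite mE ?mul1n ?eqxx //.
by rewrite -mul2n ltn_pmul2r ?cardG_gt0.
Qed.

Lemma zero_coset_sum_deriv (f : {poly F}) :
  #|G|.+1%:R = 0 :> F -> (size f <= ((#|G|.+1).*2).-1)%N ->
  \sum_(a in zero_coset G beta) f^`().[a] = 0.
Proof.
move=> char_dvd f_lt.
have f'_le : (size f^`() <= #|G|.*2)%N.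
  apply: (leq_trans (size_poly _ _)); rewrite doubleS /= in f_lt.
  by rewrite -subn1 leq_subLR add1n.
under eq_bigr do rewrite (horner_coef_wide _ f'_le).
rewrite exchange_big big1 //= => i _; rewrite -mulr_sumr coef_deriv.
(* The coefficient of f' at exponent |G| carries the factor |G| + 1, zero in [F]; at any other
   exponent the power sum vanishes. *)
have [->|i_neq] := eqVneq (i : nat) #|G|.
  by rewrite -mulr_natr char_dvd mulr0 mul0r.
by rewrite zero_coset_power_sum ?mulr0.
Qed.

End ZeroCoset.

Theorem theorem14 (F : finFieldType) (r : nat) (G : {group {unit F}})
    (beta : F) (p : nat) (lambda : F) (u : F -> F)
    (hG : #|G| = (r - 1)%N)
    (hbeta : beta != 0)
    (hp : p \in [pchar F])
    (hpr : (p %| r)%N)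
    (hlambda : lambda != 0)
    (hu : forall a : F, a \in zero_coset G beta -> u a != 0) :
  #|zero_coset G beta| = r /\
  forall alpha : r.-tuple F,
    uniq alpha -> alpha =i zero_coset G beta ->
    reverse_self_dual (HRS r alpha (pair_multiplier alpha lambda u)).
Proof.
have rE : #|G|.+1 = r.
  (* The subtraction in [hG] is truncated; since a group is nonempty, r - 1 is positive and no
     truncation occurs. *)
  have : (0 < r - 1)%N by rewrite -hG cardG_gt0.
  by rewrite hG subn_gt0 subn1 => /ltnW/prednK.
split; first by rewrite card_zero_coset.
move=> alpha alpha_uniq alphaE.
apply: pair_multiplier_self_dual => // [a|f f_lt].
  by rewrite alphaE; apply: hu.
rewrite big_uniq //= (eq_bigl _ _ alphaE).
apply: zero_coset_sum_deriv; rewrite ?rE //.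
by apply/eqP; rewrite -(dvdn_pcharf hp).
Qed.
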